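(* If $n\geq 3$ then the quotient group $B_n/[P_n,P_n]$ has no finite-order element of even order.
   Context: $B_n$ is the Artin braid group with generators $\sigma_1,\ldots,\sigma_{n-1}$ and relations $\sigma_i\sigma_j=\sigma_j\sigma_i$ for $|i-j|\geq 2$, and $\sigma_{i+1}\sigma_i\sigma_{i+1}=\sigma_i\sigma_{i+1}\sigma_i$ for $1\leq i\leq n-2$. $P_n$ is the pure braid group, i.e. the kernel of the homomorphism $\sigma\colon B_n\to S_n$ with $\sigma(\sigma_i)=(i,i+1)$, and $[P_n,P_n]$ is its commutator subgroup. *)

(* Defs.v *)
From HB Require Import structures.
From mathcomp Require Import all_boot fingroup perm.
From mathcomp Require Import boolp classical_sets generic_quotient.
From mathcomp Require Import zify.

Set Implicit Arguments.
Unset Strict Implicit.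
Unset Printing Implicit Defensive.

Local Open Scope classical_set_scope.
Local Open Scope quotient_scope.
Local Open Scope group_scope.

(* All groups are possibly infinite [groupType]s; subsets and subgroups are
   classical sets, and equivalences are made boolean classically so that
   quotients are groups for Leibniz equality. *)

Section PresentedGroup.
Variable X : choiceType.

(* The letter (x, false) is the generator x, and (x, true) its inverse. *)
Definition word := seq (X * bool).

Variable rel : word -> word -> Prop.

Inductive word_equiv : word -> word -> Prop :=
| word_equiv_refl u : word_equiv u u
| word_equiv_sym u v : word_equiv u v -> word_equiv v u
| word_equiv_trans u v w : word_equiv u v -> word_equiv v w -> word_equiv u w
| word_equiv_cat u u' v v' :
    word_equiv u u' -> word_equiv v v' -> word_equiv (u ++ v) (u' ++ v')
| word_equiv_cancel x b : word_equiv [:: (x, b); (x, ~~ b)] [::]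
| word_equiv_rel u v : rel u v -> word_equiv u v.

Definition word_equivb (u v : word) : bool := `[< word_equiv u v >].

Lemma word_equivb_refl : reflexive word_equivb.
Proof. by move=> u; apply/asboolP; exact: word_equiv_refl. Qed.

Lemma word_equivb_sym : symmetric word_equivb.
Proof.
by move=> u v; apply/idP/idP => /asboolP uv; apply/asboolP; exact: word_equiv_sym.
Qed.

Lemma word_equivb_trans : transitive word_equivb.
Proof.
by move=> v u w /asboolP uv /asboolP vw; apply/asboolP/(word_equiv_trans uv vw).
Qed.

Canonical word_equiv_rel_canonical :=
  EquivRel word_equivb word_equivb_refl word_equivb_sym word_equivb_trans.

(* The group < X | u = v for (u, v) in rel >. *)
Definition presented : Type := {eq_quot word_equivb}.
HB.instance Definition _ := Choice.on presented.

Definition presented_class (u : word) : presented := \pi_{eq_quot word_equivb} u.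
Definition presented_repr (a : presented) : word := repr a.

Lemma presented_reprK : cancel presented_repr presented_class.
Proof. exact: reprK. Qed.

Lemma presentedP (u v : word) :
  presented_class u = presented_class v <-> word_equiv u v.
Proof.
split; first by move/eqP; rewrite eqmodE => /asboolP.
by move=> uv; apply/eqP; rewrite eqmodE; apply/asboolP.
Qed.

Definition word_inv (u : word) : word := rev [seq (a.1, ~~ a.2) | a <- u].

Lemma word_invK : involutive word_inv.
Proof.
move=> u; rewrite /word_inv map_rev revK -map_comp map_id_in//.
by case=> x b _ /=; rewrite negbK.
Qed.

Lemma word_inv_cat u v : word_inv (u ++ v) = word_inv v ++ word_inv u.
Proof. by rewrite /word_inv map_cat rev_cat. Qed.

Lemma word_equiv_catV u : word_equiv (u ++ word_inv u) [::].
Proof.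
elim: u => [|[x b] u IHu]; first exact: word_equiv_refl.
rewrite -cat1s word_inv_cat -catA (catA u).
apply: (word_equiv_trans _ (word_equiv_cancel x b)).
rewrite -[[:: (x, b); _]]cat1s; apply: word_equiv_cat (word_equiv_refl _) _.
rewrite -[X in word_equiv _ X]cat0s.
exact: word_equiv_cat IHu (word_equiv_refl _).
Qed.

Lemma word_equiv_Vcat u : word_equiv (word_inv u ++ u) [::].
Proof. by rewrite -{2}[u]word_invK; exact: word_equiv_catV. Qed.

Lemma word_equiv_inv u v : word_equiv u v -> word_equiv (word_inv u) (word_inv v).
Proof.
move=> uv; rewrite -[word_inv u]cats0.
apply: (word_equiv_trans (v := word_inv u ++ (v ++ word_inv v))).
  apply: word_equiv_cat (word_equiv_refl _) _.
  exact: word_equiv_sym (word_equiv_catV v).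
rewrite catA -[X in word_equiv _ X]cat0s.
apply: word_equiv_cat (word_equiv_refl _).
apply: (word_equiv_trans (v := word_inv u ++ u)); last exact: word_equiv_Vcat.
by apply: word_equiv_cat (word_equiv_refl _) _; exact: word_equiv_sym.
Qed.

Definition presented_one : presented := presented_class [::].
Definition presented_mul (a b : presented) : presented :=
  presented_class (presented_repr a ++ presented_repr b).
Definition presented_inv (a : presented) : presented :=
  presented_class (word_inv (presented_repr a)).

Lemma presented_repr_equiv (u : word) : word_equiv (presented_repr (presented_class u)) u.
Proof. by apply/presentedP; rewrite [LHS]presented_reprK. Qed.

Lemma presented_mulE u v :
  presented_mul (presented_class u) (presented_class v) = presented_class (u ++ v).
Proof. by apply/presentedP/word_equiv_cat; exact: presented_repr_equiv. Qed.

Lemma presented_invE u : presented_inv (presented_class u) = presented_class (word_inv u).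
Proof. by apply/presentedP/word_equiv_inv; exact: presented_repr_equiv. Qed.

Lemma presented_mulA : associative presented_mul.
Proof.
move=> a b c; rewrite -[a]presented_reprK -[b]presented_reprK -[c]presented_reprK.
by rewrite !presented_mulE catA.
Qed.

Lemma presented_mul1g : left_id presented_one presented_mul.
Proof. by move=> a; rewrite -[a]presented_reprK presented_mulE. Qed.

Lemma presented_mulg1 : right_id presented_one presented_mul.
Proof. by move=> a; rewrite -[a]presented_reprK presented_mulE cats0. Qed.

Lemma presented_mulVg : left_inverse presented_one presented_inv presented_mul.
Proof.
move=> a; rewrite -[a]presented_reprK presented_invE presented_mulE.
by apply/presentedP; exact: word_equiv_Vcat.
Qed.

Lemma presented_mulgV : right_inverse presented_one presented_inv presented_mul.
Proof.
move=> a; rewrite -[a]presented_reprK presented_invE presented_mulE.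
by apply/presentedP; exact: word_equiv_catV.
Qed.

HB.instance Definition _ := isGroup.Build presented presented_mulA
  presented_mul1g presented_mulg1 presented_mulVg presented_mulgV.

Definition presented_gen (x : X) : presented := presented_class [:: (x, false)].

Lemma presented_classM u v :
  presented_class (u ++ v) = presented_class u * presented_class v.
Proof. by rewrite -presented_mulE. Qed.

Section Lift.
Variables (H : groupType) (f : X -> H).

Definition word_eval (u : word) : H :=
  \prod_(a <- u) (if a.2 then (f a.1)^-1 else f a.1).

Lemma word_eval_cat u v : word_eval (u ++ v) = word_eval u * word_eval v.
Proof. by rewrite /word_eval big_cat. Qed.

Hypothesis f_rel : forall u v, rel u v -> word_eval u = word_eval v.

Lemma word_eval_equiv u v : word_equiv u v -> word_eval u = word_eval v.
Proof.
elim=> {u v} // [u v w _ -> _ //|u u' v v' _ Eu _ Ev|x b].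
  by rewrite !word_eval_cat Eu Ev.
by rewrite /word_eval !big_cons big_nil; case: b; rewrite /= mulg1 ?mulgV ?mulVg.
Qed.

(* The morphism induced by f; the proof that f respects rel is an argument, for
   the morphism instance below to be inferred from it. *)
Definition presented_lift of (forall u v, rel u v -> word_eval u = word_eval v) :=
  fun a : presented => word_eval (presented_repr a).

Lemma presented_lift_class u : presented_lift f_rel (presented_class u) = word_eval u.
Proof. exact/word_eval_equiv/presented_repr_equiv. Qed.

Lemma presented_lift_gen x : presented_lift f_rel (presented_gen x) = f x.
Proof. by rewrite presented_lift_class /word_eval big_seq1. Qed.

Lemma presented_lift_monoid_morphism : monoid_morphism (presented_lift f_rel).
Proof.
split=> [|a b]; first by rewrite presented_lift_class /word_eval big_nil.
rewrite -[a]presented_reprK -[b]presented_reprK -presented_classM !presented_lift_class.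
exact: word_eval_cat.
Qed.

End Lift.

HB.instance Definition _ (H : groupType) (f : X -> H)
    (f_rel : forall u v, rel u v -> word_eval f u = word_eval f v) :=
  isUMagmaMorphism.Build presented H (presented_lift f_rel)
    (presented_lift_monoid_morphism f_rel).

End PresentedGroup.

Record normalSubgroup (G : groupType) := NormalSubgroup {
  nsub_set :> set G;
  nsub_group_closed : group_closed [in nsub_set];
  nsub_conjg : forall x y : G, nsub_set x -> nsub_set (x ^ y)
}.

Section NormalSubgroupTheory.
Variables (G : groupType) (N : normalSubgroup G).

Lemma nsub1 : nsub_set N 1.
Proof. by have [+ _] := nsub_group_closed N; rewrite !inE. Qed.

Lemma nsubF x y : nsub_set N x -> nsub_set N y -> nsub_set N (x / y).
Proof.
have [_ NF] := nsub_group_closed N; move=> Nx Ny.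
by have := NF x y; rewrite !inE; exact.
Qed.

Lemma nsubV x : nsub_set N x -> nsub_set N x^-1.
Proof. by move=> Nx; rewrite -[_^-1]mul1g; apply: nsubF => //; exact: nsub1. Qed.

Lemma nsubM x y : nsub_set N x -> nsub_set N y -> nsub_set N (x * y).
Proof. by move=> Nx Ny; rewrite -[y]invgK; apply: nsubF => //; exact: nsubV. Qed.

Definition coset_rel (x y : G) : bool := `[< nsub_set N (x^-1 * y) >].

Lemma coset_rel_refl : reflexive coset_rel.
Proof. by move=> x; apply/asboolP; rewrite mulVg; exact: nsub1. Qed.

Lemma coset_rel_sym : symmetric coset_rel.
Proof.
by move=> x y; apply/idP/idP => /asboolP/nsubV Nxy; apply/asboolP;
   rewrite invgM invgK in Nxy.
Qed.

Lemma coset_rel_trans : transitive coset_rel.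
Proof.
move=> y x z /asboolP Nxy /asboolP Nyz; apply/asboolP.
by have := nsubM Nxy Nyz; rewrite -mulgA mulKVg.
Qed.

Canonical coset_rel_canonical :=
  EquivRel coset_rel coset_rel_refl coset_rel_sym coset_rel_trans.

(* The group G / N; x and y are identified when x^-1 * y belongs to N. *)
Definition quotg : Type := {eq_quot coset_rel}.
HB.instance Definition _ := Choice.on quotg.

Definition quotg_class (u : G) : quotg := \pi_{eq_quot coset_rel} u.
Definition quotg_repr (a : quotg) : G := repr a.

Lemma quotg_reprK : cancel quotg_repr quotg_class.
Proof. exact: reprK. Qed.

Lemma quotgP (x y : G) : quotg_class x = quotg_class y <-> nsub_set N (x^-1 * y).
Proof.
split; first by move/eqP; rewrite eqmodE => /asboolP.
by move=> uv; apply/eqP; rewrite eqmodE; apply/asboolP.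
Qed.

Definition quotg_one : quotg := quotg_class 1.
Definition quotg_mul (a b : quotg) : quotg := quotg_class (quotg_repr a * quotg_repr b).
Definition quotg_inv (a : quotg) : quotg := quotg_class (quotg_repr a)^-1.

Lemma quotg_reprP (x : G) : nsub_set N ((quotg_repr (quotg_class x))^-1 * x).
Proof. by apply/quotgP; rewrite quotg_reprK. Qed.

Lemma quotg_mulE x y : quotg_mul (quotg_class x) (quotg_class y) = quotg_class (x * y).
Proof.
have Nx := quotg_reprP x; have Ny := quotg_reprP y.
apply/quotgP; have := nsubM (nsub_conjg (quotg_repr (quotg_class y)) Nx) Ny.
by rewrite conjgE -!mulgA mulKVg invgM -!mulgA.
Qed.

Lemma quotg_invE x : quotg_inv (quotg_class x) = quotg_class x^-1.
Proof.
have /nsubV := quotg_reprP x; rewrite invgM invgK => Nx.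
apply/quotgP; have := nsub_conjg x^-1 Nx.
by rewrite conjgE !invgK -!mulgA mulVKg.
Qed.

Lemma quotg_mulA : associative quotg_mul.
Proof.
by move=> a b c; rewrite -[a]quotg_reprK -[b]quotg_reprK -[c]quotg_reprK !quotg_mulE mulgA.
Qed.

Lemma quotg_mul1g : left_id quotg_one quotg_mul.
Proof. by move=> a; rewrite -[a]quotg_reprK quotg_mulE mul1g. Qed.

Lemma quotg_mulg1 : right_id quotg_one quotg_mul.
Proof. by move=> a; rewrite -[a]quotg_reprK quotg_mulE mulg1. Qed.

Lemma quotg_mulVg : left_inverse quotg_one quotg_inv quotg_mul.
Proof. by move=> a; rewrite -[a]quotg_reprK quotg_invE quotg_mulE mulVg. Qed.

Lemma quotg_mulgV : right_inverse quotg_one quotg_inv quotg_mul.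
Proof. by move=> a; rewrite -[a]quotg_reprK quotg_invE quotg_mulE mulgV. Qed.

HB.instance Definition _ := isGroup.Build quotg quotg_mulA
  quotg_mul1g quotg_mulg1 quotg_mulVg quotg_mulgV.

Lemma quotg_classM (x y : G) : quotg_class (x * y) = quotg_class x * quotg_class y.
Proof. by rewrite -quotg_mulE. Qed.

End NormalSubgroupTheory.

Section Kernel.
Variables (G H : groupType) (f : UMagmaMorphism.type G H).

Definition ker_set : set G := [set x | f x = 1].

Lemma ker_group_closed : group_closed [in ker_set].
Proof.
split; first by rewrite !inE /ker_set /= gmulf1.
by move=> x y; rewrite !inE /ker_set /= gmulfF => -> ->; rewrite divgg.
Qed.

Lemma ker_conjg (x y : G) : ker_set x -> ker_set (x ^ y).
Proof. by rewrite /ker_set /= gmulfJ => ->; rewrite conj1g. Qed.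

Definition kerg : normalSubgroup G := NormalSubgroup ker_group_closed ker_conjg.

End Kernel.

(* The commutator subgroup [A, B], generated by the commutators of elements of
   A with elements of B. *)
Definition commutator_set (G : groupType) (A B : set G) : set G :=
  smallest (fun M : set G => group_closed [in M])
    [set [~ x, y] | x in A & y in B].

Section Derived.
Variables (G : groupType) (N : normalSubgroup G).

Lemma commutator_group_closed : group_closed [in commutator_set N N].
Proof.
split; first by rewrite !inE => M [[M1 _] _]; rewrite inE in M1.
move=> x y; rewrite !inE => Nx Ny M [Mgrp sM].
have Mx := Nx M (conj Mgrp sM); have My := Ny M (conj Mgrp sM).
by have := Mgrp.2 x y; rewrite !inE; exact.
Qed.

Lemma commutator_conjg (x y : G) :
  commutator_set N N x -> commutator_set N N (x ^ y).
Proof.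
move=> Nx M [[M1 MF] sM]; apply: (Nx [set z | M (z ^ y)]); split.
  split; first by rewrite !inE /= conj1g; rewrite inE in M1.
  move=> u v; rewrite !inE /= => Mu Mv; rewrite conjMg conjVg.
  by have := MF (u ^ y) (v ^ y); rewrite !inE; exact.
move=> _ [u Nu [v Nv <-]] /=; rewrite conjRg; apply: sM.
by exists (u ^ y); [exact: nsub_conjg | exists (v ^ y) => //; exact: nsub_conjg].
Qed.

Definition derivedg : normalSubgroup G :=
  NormalSubgroup commutator_group_closed commutator_conjg.

End Derived.

Definition has_order (G : groupType) (x : G) (k : nat) : Prop :=
  [/\ (0 < k)%N, x ^+ k = 1 &
      forall m : nat, (0 < m)%N -> x ^+ m = 1 -> (k <= m)%N].

Section Braid.
Variable n : nat.

Local Notation s i := (i, false).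

(* The usual generator sigma_(i+1) is indexed by i : 'I_n.-1. *)
Inductive artin_rel : word 'I_n.-1 -> word 'I_n.-1 -> Prop :=
| artin_far (i j : 'I_n.-1) of (i.+2 <= j)%N || (j.+2 <= i)%N :
    artin_rel [:: s i; s j] [:: s j; s i]
| artin_braid (i j : 'I_n.-1) of j = i.+1 :> nat :
    artin_rel [:: s j; s i; s j] [:: s i; s j; s i].

Definition braid : Type := presented artin_rel.
HB.instance Definition _ := Group.on braid.

Definition braid_gen (i : 'I_n.-1) : braid := presented_gen artin_rel i.

Lemma braid_strand_subproof (i : 'I_n.-1) : (i.+1 < n)%N.
Proof. by rewrite -ltn_predRL. Qed.

Definition strand_l (i : 'I_n.-1) : 'I_n := widen_ord (leq_pred n) i.
Definition strand_r (i : 'I_n.-1) : 'I_n := Ordinal (braid_strand_subproof i).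

Definition adj_tperm (i : 'I_n.-1) : 'S_n := tperm (strand_l i) (strand_r i).

Lemma adj_tperm_rel u v :
  artin_rel u v -> word_eval adj_tperm u = word_eval adj_tperm v.
Proof.
rewrite /word_eval; case=> {u v} i j ij; rewrite !big_cons !big_nil /= !mulg1.
  apply/commgP/conjg_fixP; rewrite /adj_tperm tpermJ.
  by rewrite !tpermD // -val_eqE /=; case/orP: ij => ij; lia.
have eq_lr : strand_l j = strand_r i by apply: val_inj; rewrite /= ij.
rewrite /adj_tperm eq_lr.
set a := strand_l i; set b := strand_r i; set c := strand_r j.
have [ab ac bc] : [/\ a != b, a != c & b != c].
  by rewrite -!val_eqE /=; split; lia.
have Vt (x y : 'I_n) : (tperm x y)^-1 = tperm x y by exact: tpermV.
have -> : tperm b c * (tperm a b * tperm b c) = tperm a b ^ tperm b c.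
  by rewrite conjgE Vt.
have -> : tperm a b * (tperm b c * tperm a b) = tperm b c ^ tperm a b.
  by rewrite conjgE Vt.
rewrite !tpermJ tpermL tpermR (tpermD (x := b)) ?(tpermD (x := a)) //.
all: by rewrite eq_sym.
Qed.

(* The morphism sigma : B_n -> S_n with sigma (sigma_i) = (i, i+1). Products in
   'S_n compose from left to right; the opposite convention gives the same
   kernel. *)
Definition braid_perm : braid -> 'S_n := presented_lift adj_tperm_rel.
HB.instance Definition _ := UMagmaMorphism.on braid_perm.

Lemma braid_perm_gen (i : 'I_n.-1) : braid_perm (braid_gen i) = adj_tperm i.
Proof. exact: presented_lift_gen. Qed.

Definition pure_braid : normalSubgroup braid := kerg braid_perm.

End Braid.

(* Main.v *)
(** Counting crossings of strands with sign defines a morphism from B_n to the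
    semidirect product of Z^(pairs of strands) by S_n, whose kernel is
    [P_n, P_n]: pure braids are products of conjugates of a generator's square,
    modulo [P_n, P_n] these conjugates commute and depend only on the two
    strands they link, and each counts for 2 crossings of these strands.
    If x^2 maps to 1 but x does not, then the permutation of x is a nontrivial
    involution, so it swaps two strands i and j; the number of crossings of i
    and j in x is then odd, hence nonzero, and it is doubled in x^2.  So
    x^2 = 1 implies x = 1 in B_n/[P_n, P_n]. *)
Require Import Defs.
From HB Require Import structures.
From mathcomp Require Import all_boot fingroup perm ssralg ssrint.
From mathcomp Require Import boolp classical_sets zify.

Set Implicit Arguments.
Unset Strict Implicit.
Unset Printing Implicit Defensive.
Local Open Scope group_scope.

(** * Coset normal forms under Coxeter relations of type A *)

Section CoxeterCosets.
Variables (G : groupType) (s : nat -> G) (r : nat).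
Hypothesis s_sqr : forall i, (i <= r)%N -> s i * s i = 1.
Hypothesis s_far : forall i j, (i.+2 <= j <= r)%N -> s i * s j = s j * s i.
Hypothesis s_braid :
  forall i, (i < r)%N -> s i.+1 * s i * s i.+1 = s i * s i.+1 * s i.

(** For [k <= m.+1], the words [descent m.+1 k] are the standard representatives of the m + 2 cosets
    of the symmetric group on m + 1 points in the one on m + 2 points. *)
Definition descent m k : seq nat := rev (iota k (m - k)).

Lemma descent_cat m j k :
  (k <= j <= m)%N -> descent m k = descent m j ++ descent j k.
Proof.
move=> kjm; rewrite /descent -rev_cat; congr rev.
have -> : (m - k = (j - k) + (m - j))%N by lia.
by rewrite iotaD; congr (_ ++ iota _ _); lia.
Qed.

Lemma descent1 k : descent k.+1 k = [:: k].
Proof. by rewrite /descent subSnn. Qed.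

Lemma mem_descent m k i : (i \in descent m k) = (k <= i < m)%N.
Proof. rewrite mem_rev mem_iota; lia. Qed.

Lemma commute_prod_seq (x : G) (u : seq nat) :
  (forall i, i \in u -> x * s i = s i * x) ->
  x * \prod_(i <- u) s i = \prod_(i <- u) s i * x.
Proof.
elim: u => [|i u IHu] xu; first by rewrite big_nil mulg1 mul1g.
rewrite big_cons mulgA xu ?mem_head // -!mulgA IHu // => j uj.
by apply: xu; rewrite in_cons uj orbT.
Qed.

(** Right multiplication by [s j] permutes the cosets: it slides to the left if j + 1 < k, lengthens
    the descent if j + 1 = k, cancels its last letter if j = k, and comes out on the left as
    [s j.-1] by the braid relation if j > k. *)
Lemma descent_mul_gen m k j : (k <= m.+1)%N -> (m <= r)%N -> (j <= m)%N ->
  exists k' v, [/\ (k' <= m.+1)%N, all (ltn^~ m) v &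
    \prod_(i <- descent m.+1 k) s i * s j =
    \prod_(i <- v) s i * \prod_(i <- descent m.+1 k') s i].
Proof.
move=> km mr jm; have [jk|kj|<-] := ltngtP j k.
- have [{}jk|] := ltnP j.+1 k.
    exists k, [:: j]; rewrite big_seq1 /=; split=> //; first by lia.
    by rewrite commute_prod_seq // => i; rewrite mem_descent => ?; apply: s_far; lia.
  move=> kj; have -> : k = j.+1 by lia.
  exists j, [::]; rewrite big_nil mul1g; split=> //; first by lia.
  by rewrite (@descent_cat _ j.+1 j) ?descent1 ?big_cat ?big_seq1 //; lia.
- exists k, [:: j.-1]; rewrite big_seq1 /=; split=> //; first by lia.
  case: j kj jm => [//|j] kj jm; rewrite -pred_Sn.
  rewrite (@descent_cat _ j.+2 k); last by lia.
  rewrite (@descent_cat j.+2 j.+1 k) ?(@descent_cat j.+1 j k) ?descent1; try by lia.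
  rewrite !big_cat !big_seq1 /= -!mulgA.
  rewrite -(commute_prod_seq (x := s j.+1) (u := descent j k)); last first.
    move=> i; rewrite mem_descent => ij; apply/esym/s_far; lia.
  rewrite !mulgA -(mulgA _ (s j.+1) (s j)) -(mulgA _ (s j.+1 * s j)) s_braid; last by lia.
  rewrite !mulgA (commute_prod_seq (x := s j)) // => i.
  by rewrite mem_descent => ij; apply: s_far; lia.
- exists j.+1, [::]; rewrite big_nil mul1g; split=> //.
  rewrite (@descent_cat _ j.+1 j) ?descent1 ?big_cat ?big_seq1 /=; last by lia.
  by rewrite -mulgA s_sqr ?mulg1 //; lia.
Qed.

(** Letters are appended one at a time and absorbed by [descent_mul_gen]; the tail names the coset,
    and the prefix [v] avoids the top generator. *)
Lemma coxeter_coset m (u : seq nat) : (m <= r)%N -> all (ltn^~ m.+1) u ->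
  exists k v, [/\ (k <= m.+1)%N, all (ltn^~ m) v &
    \prod_(i <- u) s i = \prod_(i <- v ++ descent m.+1 k) s i].
Proof.
move=> mr; elim/last_ind: u => [_|u j IHu].
  by exists m.+1, [::]; rewrite /descent subnn.
rewrite all_rcons => /andP[jm /IHu[k [v [km vm Eu]]]].
have [k' [w [km' wm Ew]]] := descent_mul_gen km mr jm.
exists k', (v ++ w); rewrite all_cat vm wm; split=> //.
by rewrite -cats1 -catA !big_cat Eu big_cat big_seq1 /= -mulgA Ew.
Qed.

End CoxeterCosets.

(** * Cancellation in signed products of commuting elements *)

Section Cancellation.
Variables (G : groupType) (T : Type) (K : eqType) (key : T -> K) (val : T -> G).
Hypothesis val_commute : forall a b, commute (val a) (val b).
Hypothesis val_key : forall a b, key a = key b -> val a = val b.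

Definition signed_val (l : T * bool) : G := if l.2 then (val l.1)^-1 else val l.1.

Definition signed_key (k : K) (b : bool) : pred (T * bool) :=
  fun l => (key l.1 == k) && (l.2 == b).

Lemma signed_val_commute l l' : commute (signed_val l) (signed_val l').
Proof.
rewrite /signed_val; case: l l' => [a []] [b []] /=.
- exact/commuteV/commute_sym/commuteV.
- exact/commute_sym/commuteV.
- exact/commuteV.
- exact: val_commute.
Qed.

(** By balance, the first letter has an opposite with the same key further on; commutation brings
    the two together, and removing both keeps the balance. *)
Lemma balanced_prod (s : seq (T * bool)) :
  (forall k, count (signed_key k true) s = count (signed_key k false) s) ->
  \prod_(l <- s) signed_val l = 1.
Proof.
have [m] := ubnP (size s); elim: m s => // m IHm [|[a b] s] /= sm bal.
  by rewrite big_nil.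
have : has (signed_key (key a) (~~ b)) s.
  rewrite has_count; have := bal (key a); rewrite /signed_key /= eqxx.
  by case: (b) => /=; rewrite /signed_key; lia.
move=> has_opp; move: bal sm.
case: (split_find has_opp) => c s1 s2 /andP[/eqP kc /eqP cb] _ bal sm.
rewrite big_cons -cats1 !big_cat big_seq1 /=.
have -> : signed_val c = (signed_val (a, b))^-1.
  by rewrite /signed_val cb (val_key kc) /=; case: (b); rewrite ?invgK.
rewrite !mulgA.
have -> : signed_val (a, b) * \prod_(l <- s1) signed_val l =
    \prod_(l <- s1) signed_val l * signed_val (a, b).
  by apply: commute_prod => l _; exact: signed_val_commute.
rewrite mulgK -big_cat IHm ?size_cat // => [|k]; last first.
  have := bal k; rewrite -cats1 !count_cat /= /signed_key /= kc cb.
  by case: (key a == k); case: (b) => /=; lia.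
by move: sm; rewrite size_cat size_rcons; lia.
Qed.
End Cancellation.

(** * The crossing morphism and the parity of its counts *)

Section Crossings.
Import GRing.Theory.
Variable n : nat.

(* The semidirect product of Z^(subsets of 'I_n) with 'S_n. Only the pairs of
   strands matter; allowing all subsets avoids a subtype. *)
Definition crossings : Type := ({ffun {set 'I_n} -> int} * 'S_n)%type.
HB.instance Definition _ := Choice.on crossings.

Definition crossings_one : crossings := ([ffun=> 0%R], 1).
(** Strands are labelled by their initial positions: those starting [x] in [A] enter [y] at the
    positions [x.2 @: A]. *)
Definition crossings_mul (x y : crossings) : crossings :=
  ([ffun A => x.1 A + y.1 (x.2 @: A)]%R, x.2 * y.2).
Definition crossings_inv (x : crossings) : crossings :=
  ([ffun A : {set 'I_n} => - x.1 (x.2^-1%g @: A)]%R, x.2^-1).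

Lemma imset_perm1 (T : finType) (A : {set T}) : (1 : {perm T}) @: A = A.
Proof. by rewrite -[RHS]imset_id; apply: eq_imset => x; rewrite perm1. Qed.

Lemma imset_permM (T : finType) (p q : {perm T}) (A : {set T}) :
  (p * q) @: A = q @: (p @: A).
Proof. by rewrite -imset_comp; apply: eq_imset => x; rewrite permM. Qed.

Lemma crossings_mulA : associative crossings_mul.
Proof.
move=> x y z; congr pair; last exact: mulgA.
by apply/ffunP => A; rewrite !ffunE /= imset_permM addrA.
Qed.

Lemma crossings_mul1g : left_id crossings_one crossings_mul.
Proof.
move=> [v p]; congr pair; last exact: mul1g.
by apply/ffunP => A; rewrite !ffunE /= imset_perm1 add0r.
Qed.

Lemma crossings_mulg1 : right_id crossings_one crossings_mul.
Proof.
move=> [v p]; congr pair; last exact: mulg1.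
by apply/ffunP => A; rewrite !ffunE addr0.
Qed.

Lemma crossings_mulVg : left_inverse crossings_one crossings_inv crossings_mul.
Proof.
move=> [v p]; congr pair; last exact: mulVg.
by apply/ffunP => A; rewrite !ffunE addNr.
Qed.

Lemma crossings_mulgV : right_inverse crossings_one crossings_inv crossings_mul.
Proof.
move=> [v p]; congr pair; last exact: mulgV.
by apply/ffunP => A; rewrite !ffunE /= -imset_permM mulgV imset_perm1 subrr.
Qed.

HB.instance Definition _ := isGroup.Build crossings crossings_mulA
  crossings_mul1g crossings_mulg1 crossings_mulVg crossings_mulgV.

Lemma crossingsM1 (x y : crossings) A : (x * y).1 A = (x.1 A + y.1 (x.2 @: A))%R.
Proof. by rewrite ffunE. Qed.

Lemma crossingsV1 (x : crossings) A : (x^-1).1 A = (- x.1 (x.2^-1%g @: A))%R.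
Proof. by rewrite ffunE. Qed.

Lemma crossings11 A : (1 : crossings).1 A = 0%R.
Proof. by rewrite ffunE. Qed.

Lemma crossingsP (x y : crossings) : x.1 =1 y.1 -> x.2 = y.2 -> x = y.
Proof. by case: x y => [v p] [w q] /= /ffunP -> ->. Qed.

Definition strands (i : 'I_n.-1) : {set 'I_n} := [set strand_l i; strand_r i].

Definition gen_crossings (i : 'I_n.-1) : crossings :=
  ([ffun A => Posz (A == strands i)], adj_tperm i).

Lemma eq_imset_perm (T : finType) (p : {perm T}) (A B : {set T}) :
  (p @: A == B) = (A == p^-1 @: B).
Proof.
apply/eqP/eqP => [<-|->]; by rewrite -imset_permM ?mulgV ?mulVg imset_perm1.
Qed.

Lemma imset_set2 (aT rT : finType) (f : aT -> rT) x y :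
  f @: [set x; y] = [set f x; f y].
Proof. by rewrite imsetU1 imset_set1. Qed.

Lemma adj_tpermV i : (adj_tperm i)^-1 = adj_tperm i :> 'S_n.
Proof. exact: tpermV. Qed.

(** In a braid relation each pair of the three strands crosses once on either side, only in a
    different order; in a far relation the two pairs are disjoint. *)
Lemma gen_crossings_rel u v :
  artin_rel u v -> word_eval gen_crossings u = word_eval gen_crossings v.
Proof.
move=> uv; have := adj_tperm_rel uv; move: uv; rewrite /word_eval.
case=> {u v} i j ij; rewrite !big_cons !big_nil /= !mulg1 => eq_perm.
all: apply: crossingsP => // A; rewrite !crossingsM1 !ffunE /=.
all: rewrite !eq_imset_perm !adj_tpermV !imset_set2 /strands /adj_tperm.
  by rewrite addrC !tpermD // -val_eqE /=; case/orP: ij => ij; lia.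
have -> : strand_l j = strand_r i by apply: val_inj; rewrite /= ij.
set a := strand_l i; set b := strand_r i; set c := strand_r j.
have [ab ac bc] : [/\ a != b, a != c & b != c].
  by rewrite -!val_eqE /=; split; lia.
have tbc_a : tperm b c a = a by rewrite tpermD // eq_sym.
have tab_c : tperm a b c = c by rewrite tpermD.
rewrite !tbc_a !tab_c !tpermL !tpermR !tbc_a !tab_c ?tpermL ?tpermR.
by rewrite addrA addrC; congr (_ + _)%R; exact: addrC.
Qed.

Definition braid_crossings : braid n -> crossings := presented_lift gen_crossings_rel.
HB.instance Definition _ := UMagmaMorphism.on braid_crossings.

Lemma braid_crossings_gen i : braid_crossings (braid_gen i) = gen_crossings i.
Proof. exact: presented_lift_gen. Qed.

Lemma braid_gen_ind (P : braid n -> Prop) :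
  P 1 -> (forall x i, P x -> P (x * braid_gen i)) ->
  (forall x i, P x -> P (x / braid_gen i)) -> forall x, P x.
Proof.
move=> P1 PM PF x; rewrite -[x]presented_reprK.
elim/last_ind: (presented_repr x) => // u [i b] IHu.
rewrite -cats1 presented_classM; case: b; last exact: PM.
have -> : presented_class (artin_rel (n := n)) [:: (i, true)] = (braid_gen i)^-1.
  exact/esym/presented_invE.
exact: PF.
Qed.

Lemma braid_crossings_perm x : (braid_crossings x).2 = braid_perm x.
Proof.
elim/braid_gen_ind: x => [|x i IHx|x i IHx]; rewrite ?gmulf1 //.
  by rewrite !gmulfM /= braid_perm_gen braid_crossings_gen -IHx.
by rewrite !gmulfF /= braid_perm_gen braid_crossings_gen -IHx.
Qed.

Lemma eq_set2 (T : finType) (x y a b : T) : x != y ->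
  ([set x; y] == [set a; b]) = (x == a) && (y == b) || (x == b) && (y == a).
Proof.
move=> xy; apply/eqP/orP => [E|[] /andP[/eqP-> /eqP->] //]; last exact: finset.setUC.
have : x \in [set a; b] by rewrite -E set21.
have : y \in [set a; b] by rewrite -E set22.
rewrite !inE; case/orP=> /eqP Ey; case/orP=> /eqP Ex; subst; rewrite ?eqxx; auto.
all: by rewrite eqxx in xy.
Qed.

(** No position lies between two adjacent ones, so exchanging them reverses the order of no other
    pair. *)
Lemma strands_inverts (k : 'I_n.-1) (i j : 'I_n) : i != j ->
  ([set i; j] == strands k) = ((i < j) (+) (adj_tperm k i < adj_tperm k j)).
Proof.
move=> ij; rewrite eq_set2 // /adj_tperm.
case: tpermP => [->|->|/eqP + /eqP +]; case: tpermP => [->|->|/eqP + /eqP +].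
all: move: ij; rewrite -!val_eqE /=; lia.
Qed.

Lemma imset_strands (k : 'I_n.-1) : adj_tperm k @: strands k = strands k.
Proof. by rewrite imset_set2 tpermL tpermR finset.setUC. Qed.

(** Each letter that crosses the two strands changes their count by 1 and reverses their order. *)
Lemma crossings_parity x (i j : 'I_n) : i != j ->
  exists z : int, (braid_crossings x).1 [set i; j] =
    (z + z + Posz ((i < j) (+) (braid_perm x i < braid_perm x j)))%R.
Proof.
move=> ij; elim/braid_gen_ind: x => [|x k [z IHz]|x k [z IHz]].
- by exists 0%R; rewrite !gmulf1 crossings11 !perm1 addbb.
- have := strands_inverts k (i := braid_perm x i) (j := braid_perm x j).
  rewrite (inj_eq perm_inj) => /(_ ij) E.
  rewrite !gmulfM /= crossingsM1 braid_crossings_gen braid_perm_gen !permM ffunE.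
  rewrite braid_crossings_perm imset_set2 E IHz.
  (* A positive letter undoing an inversion carries 1 into [z]; for an inverse letter, below,
     creating an inversion borrows 1. *)
  case: (i < j); case: (braid_perm x i < _); case: (adj_tperm k _ < _);
    solve [exists z; lia | exists (z + 1)%R; lia].
have := strands_inverts k (i := braid_perm x i) (j := braid_perm x j).
rewrite (inj_eq perm_inj) => /(_ ij) E.
rewrite !gmulfM !gmulfV /= !ffunE /= braid_crossings_gen braid_perm_gen.
rewrite adj_tpermV !permM ffunE braid_crossings_perm imset_set2.
rewrite (eq_imset_perm (adj_tperm k)) !adj_tpermV imset_strands E IHz.
case: (i < j); case: (braid_perm x i < _); case: (adj_tperm k _ < _);
  solve [exists z; lia | exists (z - 1)%R; lia].
Qed.

Lemma crossings_involution x :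
  braid_crossings (x ^+ 2) = 1 -> braid_crossings x = 1.
Proof.
rewrite expgS expg1 gmulfM; set y := braid_crossings x => yy.
have yA A : (y.1 A + y.1 (y.2 @: A) = 0)%R by rewrite -crossingsM1 yy crossings11.
have y2 : y.2 * y.2 = 1 by exact: (congr1 (fun z : crossings => z.2) yy).
have y2_1 : y.2 = 1.
  apply/permP => i; apply/eqP; rewrite perm1; apply: contraT => ij.
  have := crossings_parity x ij; rewrite -braid_crossings_perm -/y.
  have E : y.2 (y.2 i) = i by rewrite -permM y2 perm1.
  (* The involution maps this pair to itself and reverses its order, so [yA] equates twice an odd
     integer with 0. *)
  rewrite E => -[z Ez]; have := yA [set y.2 i; i].
  rewrite imset_set2 E (finset.setUC [set i]) Ez.
  by move: ij; rewrite -val_eqE /=; case: ltngtP => //= _ _; lia.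
(* Once the permutation is trivial, [yA] says that twice each count is 0. *)
apply: crossingsP => // A; rewrite crossings11.
by have := yA A; rewrite y2_1 imset_perm1; lia.
Qed.

Lemma pure_crossings x : nsub_set (pure_braid n) x -> (braid_crossings x).2 = 1.
Proof. by rewrite braid_crossings_perm. Qed.

(** Elements with trivial permutation multiply by adding counts, hence commute; the kernel is thus a
    subgroup containing every commutator of pure braids. *)
Lemma derived_crossings x :
  nsub_set (derivedg (pure_braid n)) x -> braid_crossings x = 1.
Proof.
move=> /(_ (kerg braid_crossings)); apply; split; first exact: ker_group_closed.
move=> _ [a /pure_crossings Pa [b /pure_crossings Pb <-]] /=.
rewrite /ker_set /= gmulfR; apply/eqP/commgP/crossingsP => [A|]; last first.
  by rewrite /= Pa Pb.
by rewrite !crossingsM1 Pa Pb !imset_perm1 addrC.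
Qed.

End Crossings.

(** * The quotient map as a morphism *)

Lemma quotg_class_monoid_morphism (G : groupType) (N : normalSubgroup G) :
  monoid_morphism (quotg_class N).
Proof. by split=> // x y; exact: quotg_classM. Qed.

HB.instance Definition _ (G : groupType) (N : normalSubgroup G) :=
  isUMagmaMorphism.Build G (quotg N) (quotg_class N)
    (quotg_class_monoid_morphism N).

Lemma quotg_classV (G : groupType) (N : normalSubgroup G) (x : G) :
  quotg_class N x^-1 = (quotg_class N x)^-1.
Proof. exact: gmulfV. Qed.

Lemma quotg_class1 (G : groupType) (N : normalSubgroup G) (x : G) :
  quotg_class N x = 1 <-> nsub_set N x.
Proof.
have <- : quotg_class N 1 = 1 by exact: gmulf1.
split=> [/esym/quotgP|Nx]; first by rewrite invg1 mul1g.
by apply/esym/quotgP; rewrite invg1 mul1g.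
Qed.

(** * Generators indexed by natural numbers and their permutations *)

Section PureBraids.
Variable r : nat.

Local Notation B := (braid r.+2).
Local Notation P := (pure_braid r.+2).

(** Natural indices match those of [descent]. Beyond [r], [inord] defaults to 0, hence the bounds
    assumed below. *)
Definition sigma (k : nat) : B := @braid_gen r.+2 (inord k : 'I_r.+1).

Lemma sigma_ord (i : 'I_r.+1) : sigma i = @braid_gen r.+2 i.
Proof. by rewrite /sigma inord_val. Qed.

Lemma sigma_far i j : (i.+2 <= j <= r)%N -> sigma i * sigma j = sigma j * sigma i.
Proof.
move=> ij; rewrite /sigma /braid_gen /presented_gen -!presented_classM.
apply/presentedP/word_equiv_rel/artin_far; rewrite !inordK; lia.
Qed.

Lemma sigma_braid i : (i < r)%N ->
  sigma i.+1 * sigma i * sigma i.+1 = sigma i * sigma i.+1 * sigma i.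
Proof.
move=> ir; have class3 (a b c : 'I_r.+1) :
    braid_gen (n := r.+2) a * braid_gen (n := r.+2) b * braid_gen (n := r.+2) c =
    presented_class (artin_rel (n := r.+2)) [:: (a, false); (b, false); (c, false)].
  by rewrite (presented_classM _ [:: (a, false); (b, false)] [:: (c, false)])
             (presented_classM _ [:: (a, false)] [:: (b, false)]).
rewrite /sigma !class3; apply/presentedP/word_equiv_rel/artin_braid.
by rewrite !inordK; lia.
Qed.

Lemma perm_sigma k : (k <= r)%N ->
  braid_perm (sigma k) = tperm (inord k : 'I_r.+2) (inord k.+1).
Proof.
move=> kr; rewrite braid_perm_gen /adj_tperm; congr tperm; apply: val_inj;
  by rewrite /= !inordK //; lia.
Qed.

Lemma perm_sigma_far m u : (m <= r)%N -> all (ltn^~ m) u ->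
  braid_perm (\prod_(i <- u) sigma i) (inord m.+1) = inord m.+1.
Proof.
move=> mr; elim: u => [|i u IHu] /=; first by rewrite big_nil gmulf1 perm1.
case/andP=> im /IHu IH; rewrite big_cons gmulfM permM /= perm_sigma; last by lia.
by rewrite tpermD // -val_eqE /= !inordK; lia.
Qed.

(** Permutations compose from left to right, so each letter moves the strand one position down. This
    lets the coset be read off from the image of the top strand. *)
Lemma perm_descent m k : (k <= m <= r.+1)%N ->
  braid_perm (\prod_(i <- descent m k) sigma i) (inord m) = inord k.
Proof.
elim: m => [|m IHm] km.
  by rewrite /descent sub0n big_nil gmulf1 perm1; congr inord; lia.
have [->|{}km] : k = m.+1 \/ (k <= m <= r)%N by lia.
  by rewrite /descent subnn big_nil gmulf1 perm1.
rewrite (@descent_cat _ m) ?descent1; last by lia.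
rewrite big_cat big_seq1 gmulfM permM /= perm_sigma ?tpermR; last by lia.
by apply: IHm; lia.
Qed.

(** * Normal subgroups of pure braids that contain the squared generators *)

Section Modulo.
Variable N : normalSubgroup B.
Hypothesis N_pure : forall x, nsub_set N x -> nsub_set P x.
Hypothesis N_sqr : forall i, (i <= r)%N -> nsub_set N (sigma i * sigma i).

Lemma eq_class_perm x y : quotg_class N x = quotg_class N y -> braid_perm x = braid_perm y.
Proof.
move/quotgP/N_pure; rewrite /= /ker_set /= gmulfM gmulfV => /eqP.
by rewrite -eq_mulVg1 => /eqP.
Qed.

(** The generators satisfy the Coxeter relations modulo [N]. In the normal form the top strand goes
    to position [k]; as it is fixed, the descent is empty. *)
Lemma coset_fix m u : (m <= r)%N -> all (ltn^~ m.+1) u ->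
  braid_perm (\prod_(i <- u) sigma i) (inord m.+1) = inord m.+1 ->
  exists2 v, all (ltn^~ m) v &
    quotg_class N (\prod_(i <- u) sigma i) = quotg_class N (\prod_(i <- v) sigma i).
Proof.
move=> mr um fix_m.
have [i ir|i j ij|i ir|k [v [km vm]]] :=
    @coxeter_coset _ (fun i => quotg_class N (sigma i)) r _ _ _ m u mr um.
- by rewrite -quotg_classM; apply/quotg_class1; exact: N_sqr.
- by rewrite -!quotg_classM sigma_far.
- by have := congr1 (quotg_class N) (sigma_braid ir); rewrite !quotg_classM.
rewrite -!(gmulf_prod (quotg_class N)) => E.
exists v => //; rewrite [LHS]E; congr quotg_class.
have := eq_class_perm E => /permP/(_ (inord m.+1)).
rewrite fix_m big_cat gmulfM permM /= perm_sigma_far // perm_descent; last by lia.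
move/(congr1 val); rewrite /= !inordK; try lia.
by move=> <-; rewrite /descent subnn big_nil mulg1.
Qed.

(** Modulo [N] each generator is its own inverse. *)
Lemma positive_class x : exists2 u, all (ltn^~ r.+1) u &
  quotg_class N x = quotg_class N (\prod_(i <- u) sigma i).
Proof.
have step y (i : 'I_r.+1) u : all (ltn^~ r.+1) u ->
    quotg_class N y = quotg_class N (\prod_(i <- u) sigma i) ->
    exists2 v, all (ltn^~ r.+1) v &
    quotg_class N (y * sigma i) = quotg_class N (\prod_(i <- v) sigma i).
  move=> ur E; exists (rcons u i); first by rewrite all_rcons ur andbT /=.
  by rewrite -cats1 big_cat big_seq1 !quotg_classM E.
elim/braid_gen_ind: x => [|x i [u ur E]|x i [u ur E]].
- by exists [::]; rewrite ?big_nil.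
- by rewrite -sigma_ord; exact: step E.
rewrite -sigma_ord; have [v vr Ev] := step x i u ur E; exists v => //.
rewrite -Ev !quotg_classM; congr (_ * _).
have /quotg_class1 : nsub_set N (sigma i * sigma i) by apply: N_sqr; rewrite -ltnS.
by rewrite quotg_classM gmulfV => /(canRL (mulKg _)); rewrite mulg1.
Qed.

(** A pure braid fixes every strand, so [coset_fix] removes the generators from the top down until
    the word is empty. Thus [P] is the normal closure of the squared generators. *)
Lemma pure_in x : nsub_set P x -> nsub_set N x.
Proof.
move=> Px; have [u ur E] := positive_class x.
apply/quotg_class1; rewrite E.
have : braid_perm (\prod_(i <- u) sigma i) = 1 by rewrite -(eq_class_perm E).
have : (r.+1 <= r.+1)%N by [].
elim: {1 2}r.+1 u ur {E} => [|m IHm] u um mr pu.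
  by case: u um {pu} => // _; rewrite big_nil.
have [|v vm E] := coset_fix mr um; first by rewrite pu perm1.
by rewrite E; apply: IHm => //; [lia | rewrite -(eq_class_perm E)].
Qed.

End Modulo.

(** * Conjugates of a squared generator modulo [D] *)

Local Notation D := (derivedg P).

(** The last two strands serve as base pair because [coset_fix] strips strands from the top. *)
Definition last_sqr : B := sigma r * sigma r.
Definition last_strands : {set 'I_r.+2} := [set inord r; inord r.+1].

(** The braid relation says that conjugating [sigma i.+1] by [sigma i * sigma i.+1] gives
    [sigma i]. *)
Lemma sigma_conj k : (k <= r)%N -> exists g, sigma k = sigma r ^ g.
Proof.
move=> kr; rewrite -(subKn kr); move: (leq_subr k r).
elim: (r - k)%N => [|m IHm] mr; first by exists 1; rewrite subn0 conjg1.
have [|g Eg] := IHm; first by lia.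
have E : (r - m = (r - m.+1).+1)%N by lia.
exists (g * (sigma (r - m.+1) * sigma (r - m))); rewrite conjgM -Eg E conjgE.
by rewrite (mulgA (sigma _.+1)) sigma_braid ?mulKg //; lia.
Qed.

Lemma sqr_pure g : nsub_set P (last_sqr ^ g).
Proof.
apply: nsub_conjg; rewrite /= /ker_set /= gmulfM /= perm_sigma //.
exact: tperm2.
Qed.

Lemma pure_commute x y : nsub_set P x -> nsub_set P y ->
  commute (quotg_class D x) (quotg_class D y).
Proof.
move=> Px Py; apply/commgP/eqP; rewrite -(gmulfR (quotg_class D)).
apply/quotg_class1 => M [_]; apply; exists x => //.
by exists y.
Qed.

Lemma sigma_sqr_pure i : (i <= r)%N -> nsub_set P (sigma i * sigma i).
Proof.
by move=> ir; have [g ->] := sigma_conj ir; rewrite -conjMg; exact: sqr_pure.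
Qed.

(** Applying [coset_fix] twice modulo [P] writes [g] as a word in generators far from [sigma r],
    times a pure braid [p]. The word commutes with [last_sqr], and [p] does so modulo [D]. *)
Lemma last_sqr_fix g : braid_perm g (inord r.+1) = inord r.+1 ->
  braid_perm g (inord r) = inord r ->
  quotg_class D (last_sqr ^ g) = quotg_class D last_sqr.
Proof.
have far_commute u : all (ltn^~ r.-1) u ->
    commute last_sqr (\prod_(i <- u) sigma i).
  move=> ur; apply/commute_sym; have c : commute (\prod_(i <- u) sigma i) (sigma r).
    apply: commute_sym; rewrite big_seq; apply: commute_prod => i /(allP ur) /= ir.
    by apply/commute_sym/sigma_far; lia.
  exact: commuteM.
have pure_sub x : nsub_set P x -> nsub_set P x by [].
have [u ur Eu] := positive_class sigma_sqr_pure g.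
rewrite (eq_class_perm pure_sub Eu) => fix1.
have [//|v vr Ev] := coset_fix pure_sub sigma_sqr_pure _ ur fix1.
rewrite (eq_class_perm pure_sub Ev) => fix2.
have [w wr Ew] : exists2 w, all (ltn^~ r.-1) w &
    quotg_class P (\prod_(i <- v) sigma i) = quotg_class P (\prod_(i <- w) sigma i).
  have [r0|[m rm]] : r = 0%N \/ exists m, r = m.+1.
    by case: (r) => [|m]; [left | right; exists m].
    exists [::] => //; move: vr; rewrite {1}r0.
    by case: (v) => //; rewrite !big_nil.
  have := @coset_fix P pure_sub sigma_sqr_pure m v; rewrite -rm => /(_ _ vr fix2).
  by have -> : r.-1 = m; [rewrite rm | apply; lia].
have /quotgP : quotg_class P (\prod_(i <- w) sigma i) = quotg_class P g.
  by rewrite -Ew -Ev -Eu.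
set p := (X in nsub_set P X) => Pp.
have -> : g = \prod_(i <- w) sigma i * p by rewrite mulKVg.
rewrite conjgM (_ : last_sqr ^ _ = last_sqr); last first.
  by apply/conjg_fixP/commgP/far_commute.
rewrite gmulfJ; apply/conjg_fixP/commgP.
by apply: pure_commute => //; have := sqr_pure 1; rewrite conjg1.
Qed.

Lemma last_sqr_stab g : braid_perm g @: last_strands = last_strands ->
  quotg_class D (last_sqr ^ g) = quotg_class D last_sqr.
Proof.
move=> stab; have := imset_f (braid_perm g) (set22 (inord r : 'I_r.+2) (inord r.+1)).
have := imset_f (braid_perm g) (set21 (inord r : 'I_r.+2) (inord r.+1)).
rewrite -/last_strands stab !inE => /orP[]/eqP gl /orP[]/eqP gr.
- by have := perm_inj (etrans gl (esym gr)) => /(congr1 val); rewrite /= !inordK; lia.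
- exact: last_sqr_fix.
(* If [g] swaps the two strands, [sigma r * g] fixes both, and [sigma r] commutes with its own
   square. *)
- have -> : last_sqr ^ g = last_sqr ^ (sigma r * g).
    by rewrite conjgM; congr (_ ^ _); rewrite conjgE /last_sqr -mulgA mulKg.
  by apply: last_sqr_fix; rewrite gmulfM permM /= perm_sigma // (tpermL, tpermR).
- by have := perm_inj (etrans gl (esym gr)) => /(congr1 val); rewrite /= !inordK; lia.
Qed.

Definition twist_strands (g : B) : {set 'I_r.+2} := braid_perm g @: last_strands.

Lemma last_sqr_conj g h : twist_strands g = twist_strands h ->
  quotg_class D (last_sqr ^ g) = quotg_class D (last_sqr ^ h).
Proof.
move=> gh; rewrite -{1}(mulgKV h g) conjgM !(gmulfJ (quotg_class D)); congr (_ ^ _).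
rewrite -(gmulfJ (quotg_class D)); apply: last_sqr_stab.
by rewrite gmulfM gmulfV imset_permM -/(twist_strands g) gh -imset_permM mulgV imset_perm1.
Qed.

(** As [last_sqr] is pure, the crossings within [g] and its inverse cancel, leaving two crossings of
    the transported pair. *)
Lemma last_sqr_crossings g A :
  (braid_crossings (last_sqr ^ g)).1 A = Posz (2 * (A == twist_strands g)).
Proof.
have last_sqr2 : (braid_crossings last_sqr).2 = 1.
  by apply: pure_crossings; have := sqr_pure 1; rewrite conjg1.
have last_sqr1 C : (braid_crossings last_sqr).1 C = Posz (2 * (C == last_strands)).
  have strandsE : strands (n := r.+2) (inord r : 'I_r.+1) = last_strands.
    by congr [set _; _]; apply: val_inj; rewrite /= !inordK.
  rewrite gmulfM /= braid_crossings_gen crossingsM1 !ffunE /= eq_imset_perm.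
  by rewrite adj_tpermV imset_strands strandsE; case: (C == last_strands).
rewrite gmulfJ conjgE !crossingsM1 crossingsV1 last_sqr1 last_sqr2 imset_perm1.
have -> : ((braid_crossings g)^-1).2 = (braid_crossings g).2^-1 by [].
rewrite eq_imset_perm invgK braid_crossings_perm -/(twist_strands g).
by rewrite GRing.addrCA GRing.addNr GRing.addr0.
Qed.

(** * Pure braids as products of twists, and the kernel of the crossing morphism *)

Definition twist_prod (l : seq (B * bool)) : B :=
  \prod_(a <- l) signed_val (fun g => last_sqr ^ g) a.

Lemma twist_prodV l : exists l', twist_prod l' = (twist_prod l)^-1.
Proof.
exists (rev [seq (a.1, ~~ a.2) | a <- l]); rewrite /twist_prod.
elim: l => [|[g b] l IHl]; first by rewrite !big_nil invg1.
rewrite map_cons rev_cons -cats1 big_cat big_seq1 IHl big_cons invgM.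
by congr (_ * _); rewrite /signed_val; case: b => //=; rewrite invgK.
Qed.

Lemma twist_prodJ l h : exists l', twist_prod l' = twist_prod l ^ h.
Proof.
exists [seq (a.1 * h, a.2) | a <- l]; rewrite /twist_prod big_map conjg_prod.
apply: eq_bigr => -[g b] _; rewrite /signed_val /=.
by case: b; rewrite ?conjVg conjgM.
Qed.

(** Shaped for [pure_in]: the first condition gives its inclusion in [P]. *)
Definition twist_products : set B :=
  [set x | nsub_set P x /\ exists l, quotg_class D x = quotg_class D (twist_prod l)].

Lemma twist_products_group_closed : group_closed [in twist_products].
Proof.
split; rewrite ?inE; first split; first exact: nsub1.
  by exists [::]; rewrite /twist_prod big_nil.
move=> x y; rewrite !inE => -[Px [l El]] [Py [l' El']].
split; first exact: nsubF.
have [l'' E] := twist_prodV l'; exists (l ++ l'').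
have -> : twist_prod (l ++ l'') = twist_prod l * twist_prod l''.
  by rewrite /twist_prod big_cat.
by rewrite E !quotg_classM !quotg_classV El El'.
Qed.

Lemma twist_products_conjg x y : twist_products x -> twist_products (x ^ y).
Proof.
move=> [Px [l El]]; split; first exact: nsub_conjg.
have [l' E] := twist_prodJ l y; exists l'; rewrite E.
by rewrite !(gmulfJ (quotg_class D)) /= El.
Qed.

Definition twistg : normalSubgroup B :=
  NormalSubgroup twist_products_group_closed twist_products_conjg.

Lemma pure_twist_prod x : nsub_set P x ->
  exists l, quotg_class D x = quotg_class D (twist_prod l).
Proof.
move=> Px; have [||_ //] := @pure_in twistg _ _ x Px; first by move=> ? [].
move=> i ir; split; first exact: sigma_sqr_pure.
have [g Eg] := sigma_conj ir; exists [:: (g, false)].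
by rewrite /twist_prod big_seq1 Eg -conjMg.
Qed.

Lemma twist_prod_crossings l A :
  (braid_crossings (twist_prod l)).1 A =
  (Posz (2 * count (signed_key twist_strands A false) l) -
   Posz (2 * count (signed_key twist_strands A true) l))%R.
Proof.
elim: l => [|[g b] l IHl]; first by rewrite /twist_prod big_nil gmulf1 crossings11.
have g2 := pure_crossings (sqr_pure g).
have signed2 : (braid_crossings (signed_val (fun h => last_sqr ^ h) (g, b))).2 = 1.
  by case: b; rewrite /signed_val ?gmulfV /= g2 ?invg1.
rewrite /twist_prod big_cons gmulfM /= crossingsM1 signed2 imset_perm1 IHl.
rewrite /signed_val /signed_key /= (eq_sym _ A).
case: b {signed2}; rewrite ?gmulfV ?crossingsV1 /= ?g2 ?invg1 ?imset_perm1.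
  by rewrite last_sqr_crossings; lia.
by rewrite last_sqr_crossings; lia.
Qed.

(** Vanishing counts mean that every pair carries as many positive as negative twists; modulo [D]
    twists commute and depend only on their pair, so all cancel. *)
Lemma crossings_inj x : braid_crossings x = 1 -> nsub_set D x.
Proof.
move=> x1; have Px : nsub_set P x.
  by rewrite /= /ker_set /= -braid_crossings_perm x1.
have [l El] := pure_twist_prod Px; apply/quotg_class1; rewrite El.
rewrite /twist_prod (gmulf_prod (quotg_class D)).
have -> : \prod_(a <- l) quotg_class D (signed_val (fun g => last_sqr ^ g) a) =
    \prod_(a <- l) signed_val (fun g => quotg_class D (last_sqr ^ g)) a.
  by apply: eq_bigr => -[g []] _ //=; rewrite /signed_val /= gmulfV.
apply: (balanced_prod (key := twist_strands)).
- by move=> g h; apply: pure_commute; exact: sqr_pure.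
- exact: last_sqr_conj.
(* [x] and its twist product differ by an element of [D], so the latter has no crossings either. *)
move=> A; have /quotgP/derived_crossings := El.
rewrite gmulfM gmulfV /= x1 invg1 mul1g => y1.
have := twist_prod_crossings l A; rewrite y1 crossings11; lia.
Qed.

End PureBraids.

Theorem theorem2 (n : nat) (n_ge3 : (3 <= n)%N) :
  ~ exists (x : quotg (derivedg (pure_braid n))) (k : nat),
      has_order x k /\ ~~ odd k.
Proof.
case: n n_ge3 => [|[|r]] // _ [x [k [[k_gt0 xk min_k] k_even]]].
(* The square of [y] lies in [D], so [y] does too; then [x ^+ k./2 = 1] contradicts the minimality
   of [k]. *)
pose y := quotg_repr x ^+ k./2.
have Ey : x ^+ k./2 = quotg_class _ y by rewrite gmulfXn /= quotg_reprK.
suff : x ^+ k./2 = 1 by move/min_k; lia.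
rewrite Ey; apply/quotg_class1; apply: crossings_inj; apply: crossings_involution.
apply: derived_crossings; apply/quotg_class1.
by rewrite expgS expg1 quotg_classM -Ey -expgnDr -[RHS]xk; congr (_ ^+ _); lia.
Qed.
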